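(* For $n\ge1$ let $\mathcal{LI}_n$ be the set of layered permutations of size $n$ that are pop-stacked. (1) $\displaystyle\sum_{n\ge1}|\mathcal{LI}_n|x^n=x+\frac{(x+x^2)^2}{1-(x+x^2+x^3)}$. (2) Let $\tau=b_1\ldots b_n\in\mathcal{LI}_n$. Call the indices $i\in\{1,\dots,n-1\}$ gaps (gap $i$ lies between positions $i$ and $i+1$). The permutations $\pi$ with $T(\pi)=\tau$ are exactly those obtained as follows: place a primary bar at every descent gap of $\tau$ (gaps $i$ with $b_i>b_{i+1}$); optionally place secondary bars at some ascent gaps of $\tau$, subject to the condition that every primary bar has at least one neighbouring gap ($i-1$ or $i+1$, within $\{1,\dots,n-1\}$) carrying no bar; then reverse each maximal block of consecutive entries delimited by the bars.
   Context: Falls of a permutation are its maximal decreasing strings of consecutive entries; runs are its maximal increasing strings of consecutive entries. The flip $T$ reverses every fall in place; a permutation is pop-stacked if it lies in the image of $T$. A layered permutation is a direct sum of decreasing permutations, i.e. a permutation that is an increasing sequence of falls (every entry of a fall is smaller than every entry of the next fall). Equivalently, layered permutations are exactly those $\pi$ with $T(\pi)=\mathrm{id}$. *)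

(* Defs.v *)
From mathcomp Require Import all_boot all_order all_fingroup all_algebra.

Set Implicit Arguments.
Unset Strict Implicit.
Unset Printing Implicit Defensive.

Import GRing.Theory.

(* One-line notation, with positions and values numbered from 1. *)
Definition word (n : nat) (s : 'S_n) : seq nat := [seq (val (s i)).+1 | i : 'I_n].

Fixpoint falls (s : seq nat) : seq (seq nat) :=
  if s isn't x :: s' then [::] else
  match falls s' with
  | (y :: f) :: fs => if y < x then (x :: y :: f) :: fs
                      else [:: x] :: (y :: f) :: fs
  | _ => [:: [:: x]]
  end.

Definition flip (s : seq nat) : seq nat := flatten (map rev (falls s)).

Definition layered (s : seq nat) : bool :=
  sorted (fun f g : seq nat => allrel ltn f g) (falls s).

Definition pop_stacked (n : nat) (t : 'S_n) : bool :=
  [exists p : 'S_n, flip (word p) == word t].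

Definition LI (n : nat) : {set 'S_n} :=
  [set t : 'S_n | layered (word t) && pop_stacked t].

(* Gap [i] lies between positions [i] and [i.+1], counted from 1, so that the
   two entries around it are [nth 0 s i.-1] and [nth 0 s i]. *)
Definition gap (s : seq nat) (i : nat) : bool := 0 < i < size s.
Definition descent_gap (s : seq nat) (i : nat) : bool :=
  gap s i && (nth 0 s i < nth 0 s i.-1).
Definition ascent_gap (s : seq nat) (i : nat) : bool :=
  gap s i && (nth 0 s i.-1 < nth 0 s i).

(* Primary bars are the descent gaps; [S] is the set of secondary bars. *)
Definition bar (s : seq nat) (S : pred nat) (i : nat) : bool :=
  descent_gap s i || S i.

Definition admissible (s : seq nat) (S : pred nat) : Prop :=
  (forall i, S i -> ascent_gap s i) /\
  (forall i, descent_gap s i ->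
     exists j, [/\ j.+1 = i \/ j = i.+1, gap s j & ~~ bar s S j]).

(* The head of the list has position [i]. *)
Fixpoint blocks_from (B : pred nat) (i : nat) (s : seq nat) : seq (seq nat) :=
  if s isn't x :: s' then [::] else
  match blocks_from B i.+1 s' with
  | b :: bs => if B i then [:: x] :: b :: bs else (x :: b) :: bs
  | [::] => [:: [:: x]]
  end.

Definition reverse_blocks (B : pred nat) (s : seq nat) : seq nat :=
  flatten (map rev (blocks_from B 1 s)).

Local Open Scope ring_scope.

(* Formal power series, given by their coefficients. *)
Definition fps (R : Type) : Type := nat -> R.

Definition fps_poly (R : nzRingType) (p : {poly R}) : fps R := fun n => p`_n.

Definition fps_add (R : nzRingType) (f g : fps R) : fps R :=
  fun n => f n + g n.

Definition fps_mul (R : nzRingType) (f g : fps R) : fps R :=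
  fun n => \sum_(i < n.+1) f i * g (n - i)%N.

(* The first [n] coefficients of the inverse of [f]; meaningful when [f 0] is
   a unit (see [fps_mulV]). *)
Fixpoint fps_inv_seq (R : unitRingType) (f : fps R) (n : nat) : seq R :=
  if n isn't m.+1 then [::] else
  let s := fps_inv_seq f m in
  rcons s ((f 0)^-1 * ((m == 0)%:R - \sum_(j < m) f (m - j)%N * s`_j)).

Definition fps_inv (R : unitRingType) (f : fps R) : fps R :=
  fun n => (fps_inv_seq f n.+1)`_n.

Definition fps_div (R : unitRingType) (f g : fps R) : fps R :=
  fps_mul f (fps_inv g).

Definition LI_series : fps int :=
  fun n => if n is 0 then 0 else #|LI n|%:R.

Lemma size_fps_inv_seq (R : unitRingType) (f : fps R) n :
  size (fps_inv_seq f n) = n.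
Proof. by elim: n => //= n IH; rewrite size_rcons IH. Qed.

Lemma nth_fps_inv_seq (R : unitRingType) (f : fps R) n j :
  (j < n)%N -> (fps_inv_seq f n)`_j = fps_inv f j.
Proof.
elim: n => // n IH; rewrite ltnS leq_eqVlt => /predU1P [-> //|ltjn].
by rewrite /= nth_rcons size_fps_inv_seq ltjn IH.
Qed.

Lemma fps_mulV (R : unitRingType) (f : fps R) :
  f 0 \is a GRing.unit -> fps_mul f (fps_inv f) =1 fps_poly 1.
Proof.
move=> f0U n; rewrite /fps_mul /fps_poly coef1 big_ord_recl subn0.
rewrite {1}/fps_inv /= nth_rcons size_fps_inv_seq ltnn eqxx mulrA divrr // mul1r.
rewrite [X in _ + X](reindex_inj rev_ord_inj) /= -addrA -[RHS]addr0; congr (_ + _).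
rewrite addrC -sumrB big1 // => j _; rewrite nth_fps_inv_seq // /bump add1n.
by rewrite subnSK // subKn ?subrr // ltnW.
Qed.

Local Close Scope ring_scope.

(* [falls s] factors [s] into nonempty decreasing factors, none of which can be
   merged with the next one, that is, into its maximal decreasing factors. *)
Lemma fallsP (s : seq nat) :
  [/\ flatten (falls s) = s,
      all (fun f => (f != [::]) && sorted gtn f) (falls s)
    & sorted (fun f g : seq nat => last 0 f <= head 0 g) (falls s)].
Proof.
elim: s => //= x s []; case: (falls s) => [<- //|[|y f] fs] //= <- /andP[dec decs] inc.
by case: ltnP => [ltyx|lexy] /=; split=> //; rewrite ?ltyx ?lexy ?dec ?decs //; case: fs inc {decs}.
Qed.

(* Main.v *)
Require Import Defs.
From mathcomp Require Import all_boot all_order all_fingroup all_algebra.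
From mathcomp Require Import zify ring.

Set Implicit Arguments.
Unset Strict Implicit.
Unset Printing Implicit Defensive.

Import GRing.Theory.

(** The preimages of tau under the flip arise by cutting tau into increasing
    blocks (so every descent is cut) and reversing each block, provided that no
    two reversed blocks merge: for consecutive blocks b, c one needs
    min b <= max c.  This is automatic at an ascent of tau.  At a descent
    y > z of a layered permutation, all entries of the other layers compare in
    the same way with y and z, so an ascent next to the descent that is not cut
    puts into the block of y an entry below z, or into the block of z an entry
    above y; if there is no such ascent, both blocks are singletons and they
    merge.

    Fewer bars are better, so tau is pop-stacked iff every descent has a
    neighbouring ascent.  In terms of layer sizes: all are at most 3, the first
    and the last are at most 2, and a single layer has size 1.  Compositions
    into parts 1, 2, 3 are counted by the coefficients of
    1 / (1 - x - x^2 - x^3). *)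

(** * Falls and blocks *)

Lemma falls_cat (f s : seq nat) :
    f != [::] -> sorted gtn f -> (s != [::] -> last 0 f <= head 0 s) ->
  falls (f ++ s) = f :: falls s.
Proof.
case: f => // x f _; elim: f x => [|y f IH] x /=.
  case: s => // y s _ /(_ isT) /= lexy.
  (* By [fallsP] the first fall of [y :: s] starts with [y], so [falls] compares [x] with [y]
     itself. *)
  case: (fallsP (y :: s)) => /=.
  case: (match falls s with [::] => _ | _ => _ end) => [//|[|z g] gs] //=.
  by case=> -> _ _ _; rewrite ltnNge lexy.
by case/andP=> ltyx sf h; move: (IH y sf h) => /= ->; rewrite ltyx.
Qed.

(** Converse of [fallsP]: the factorization into nonempty decreasing factors, no two neighbours of
    which merge, is unique. *)
Lemma falls_flatten (fs : seq (seq nat)) :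
    all (fun f => (f != [::]) && sorted gtn f) fs ->
    sorted (fun f g => last 0 f <= head 0 g) fs ->
  falls (flatten fs) = fs.
Proof.
elim: fs => //= f fs IH /andP[/andP[f0 sf] afs] pfs.
rewrite falls_cat ?IH //; first exact: path_sorted pfs.
by case: fs afs pfs {IH} => //= -[|x g] gs //= _ /andP[].
Qed.

Lemma flatten_falls s : flatten (falls s) = s.
Proof. by case: (fallsP s). Qed.

Lemma perm_flatten_rev (bs : seq (seq nat)) :
  perm_eq (flatten (map rev bs)) (flatten bs).
Proof. by elim: bs => //= b bs IH; rewrite perm_cat ?perm_rev. Qed.

Lemma map_revK (bs : seq (seq nat)) : map rev (map rev bs) = bs.
Proof. by rewrite -map_comp -[RHS]map_id; apply: eq_map => b /=; rewrite revK. Qed.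

(* [i] is the size of the union of the first [k] blocks for some [k]; hence [0]
   and the total size, which are not gaps, also count as cuts. *)
Fixpoint cut (bs : seq (seq nat)) (i : nat) : bool :=
  (i == 0) || (if bs is b :: bs' then (size b <= i) && cut bs' (i - size b) else false).

Lemma cut0 bs : cut bs 0.
Proof. by case: bs. Qed.

Lemma cut_cat bs1 bs2 k : cut bs2 k -> cut (bs1 ++ bs2) (size (flatten bs1) + k).
Proof.
move=> cb; elim: bs1 => //= b bs1 IH.
by rewrite size_cat -addnA leq_addr addKn IH orbT.
Qed.

Lemma cut_inside bs1 b bs2 k :
  0 < k < size b -> cut (bs1 ++ b :: bs2) (size (flatten bs1) + k) = false.
Proof.
move=> /andP[k0 kb]; elim: bs1 => [|c bs1 IH] /=; first by lia.
by rewrite size_cat -addnA leq_addr addKn IH; lia.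
Qed.

Lemma cut_split bs i : cut bs i ->
  exists bs1 bs2, bs = bs1 ++ bs2 /\ i = size (flatten bs1).
Proof.
elim: bs i => [|b bs IH] i /=; first by rewrite orbF => /eqP ->; exists [::], [::].
case/orP=> [/eqP ->|/andP[bi /IH[bs1 [bs2 [-> e]]]]]; first by exists [::], (b :: bs).
by exists (b :: bs1), bs2; split => //=; rewrite size_cat -e; lia.
Qed.

Lemma cut_or_inside bs i : i < size (flatten bs) ->
  cut bs i \/ exists bs1 b bs2 k,
    [/\ bs = bs1 ++ b :: bs2, i = size (flatten bs1) + k & 0 < k < size b].
Proof.
elim: bs i => [|b bs IH] i //=; rewrite size_cat.
case: (posnP i) => [->|i0]; first by left.
case: (leqP (size b) i) => bi ltis /=; last first.
  by right; exists [::], b, bs, i; rewrite i0.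
case: (IH (i - size b)); first by lia.
  by move=> ->; left.
case=> bs1 [c [bs2 [k [-> e kc]]]]; right; exists (b :: bs1), c, bs2, k.
by split=> //=; rewrite size_cat; lia.
Qed.

Lemma flatten_blocks_from B i s : flatten (blocks_from B i s) = s.
Proof.
elim: s i => //= x s IH i; move: (IH i.+1).
by case: (blocks_from B i.+1 s) => [|b bs] /= <- //; case: ifP.
Qed.

Lemma blocks_from_neq0 B i s : all (fun b => b != [::]) (blocks_from B i s).
Proof.
elim: s i => //= x s IH i; move: (IH i.+1).
by case: (blocks_from B i.+1 s) => [|b bs] //=; case: ifP => //= _ /andP[_ ->].
Qed.

(** The head of [s] has position [i.+1], so the gap after its first [j] entries has index
    [i + j]. *)
Lemma cut_blocks_from B i s j :
  0 < j < size s -> cut (blocks_from B i.+1 s) j = B (i + j).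
Proof.
elim: s i j => [|x s IH] i [|j] //= js; rewrite ltnS in js.
move: (IH i.+1 j) (flatten_blocks_from B i.+2 s) (blocks_from_neq0 B i.+2 s).
case: (blocks_from B i.+2 s) => [|b bs] /=; first by move=> _ e; rewrite -e in js.
move=> IHj _ /andP[b0 _].
have bpos : 0 < size b by case: b b0 {IHj}.
case: (posnP j) IHj => [-> _|j0 IHj]; first by case: ifP; rewrite /= addn1 => ->; lia.
rewrite addnS -addSn -IHj ?j0 //=.
by case: ifP => _ /=; rewrite ?subn1 ?subSS ?(gtn_eqF j0).
Qed.

Lemma blocks_from_cat B i (b s : seq nat) :
    b != [::] -> (forall k, 0 < k < size b -> ~~ B (i + k)) ->
    (s != [::] -> B (i + size b)) ->
  blocks_from B i.+1 (b ++ s) = b :: blocks_from B (i + size b).+1 s.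
Proof.
case: b => // x b _; elim: b x i => [|y b IH] x i /= nB Bs.
  case: s Bs => //= y s /(_ isT); rewrite addn1 => Bi.
  by case: (match blocks_from _ _ s with [::] => _ | _ => _ end) => [|b bs]; rewrite ?Bi.
have := IH y i.+1; rewrite /= => ->.
- by rewrite -addn1 (negPf (nB 1 isT)) addn1 addSnnS.
- by move=> k kb; rewrite addSnnS nB //; lia.
- by move=> s0; rewrite addSnnS Bs.
Qed.

(** Nonempty blocks are determined by their cuts inside the word. *)
Lemma blocks_from_flatten B i (bs : seq (seq nat)) :
    all (fun b => b != [::]) bs ->
    (forall j, 0 < j < size (flatten bs) -> B (i + j) = cut bs j) ->
  blocks_from B i.+1 (flatten bs) = bs.
Proof.
elim: bs i => //= b bs IH i /andP[b0 abs]; rewrite size_cat => hB.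
rewrite blocks_from_cat //.
- rewrite IH // => j jb; rewrite -addnA hB; last by lia.
  by rewrite leq_addr addKn addn_eq0 [j == 0]gtn_eqF ?andbF //; case/andP: jb.
- by move=> k kb; rewrite hB //; lia.
- move=> s0; rewrite hB; first by rewrite leqnn subnn cut0 orbT.
  by case: b b0 {hB} => // x b _; case: (flatten bs) s0 => //= y t _; lia.
Qed.

(** * Preimages under the flip *)

Definition turn (x y z : nat) : bool := (x < y) && (z < y) || (y < x) && (y < z).

Lemma layered_behead x s : layered (x :: s) -> layered s.
Proof.
rewrite /layered /=; case: (fallsP s) => _.
case: (falls s) => [|[|y f] fs] //= _ _; case: ifP => _ /=; last by case/andP.
by case: fs => //= g fs /andP[]; rewrite allrel_consl => /andP[_ ->].
Qed.

(** One of the two gaps around a turning entry [y] is an ascent, hence a boundary between layers, so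
    [x] lies in an earlier layer than [z]. *)
Lemma layered_turn s1 x y z s2 :
  layered (s1 ++ [:: x, y, z & s2]) -> turn x y z -> x < z.
Proof.
elim: s1 => [|u s1 IH] /=; last by move/layered_behead.
rewrite /layered /turn /=; case: (fallsP (z :: s2)) => /=.
case: (match falls s2 with [::] => _ | _ => _ end) => [//|[|v f] fs] //= [-> _] _ _.
case: (ltnP z y) => [ltzy|leyz] /=; case: ltnP => [ltyx|lexy] /=.
- by lia.
- by rewrite allrel1l /= => /andP[/and3P[_ -> _]].
- by rewrite allrel_consl /= => /andP[/andP[/andP[-> _]]].
- by lia.
Qed.

Lemma descent_gapP s i : descent_gap s i <->
  exists s1 x y s2, [/\ s = s1 ++ [:: x, y & s2], i = (size s1).+1 & y < x].
Proof.
split=> [/andP[/andP[i0 ltis]]|[s1 [x [y [s2 [-> -> ltyx]]]]]]; last first.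
  rewrite /descent_gap /gap size_cat /= !nth_cat ltnn subnn /=.
  have -> : (size s1).+1 < size s1 = false by lia.
  by rewrite subSnn /= ltyx; lia.
case: i i0 ltis => // i _ ltis /= lt.
exists (take i s), (nth 0 s i), (nth 0 s i.+1), (drop i.+2 s); split=> //.
  by rewrite -drop_nth // -drop_nth ?cat_take_drop // ltnW.
by rewrite size_take (ltnW ltis).
Qed.

Lemma sorted_split (T : Type) (e : rel T) s :
  (forall s1 x y s2, s = s1 ++ [:: x, y & s2] -> e x y) -> sorted e s.
Proof.
elim: s => // x [|y s] // IH h /=; apply/andP; split; first exact: (h [::]).
by apply: IH => s1 u v s2 es; apply: (h (x :: s1)); rewrite es.
Qed.

Lemma path_ltn_last x s : path ltn x s -> x <= last x s.
Proof. by elim: s x => //= y s IH x /andP[ltxy /IH]; apply: leq_trans; apply: ltnW. Qed.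

Lemma head_rcons2 (T : Type) (x0 : T) s x y :
  head x0 (rcons (rcons s x) y) = head x0 (rcons s x).
Proof. by case: s. Qed.

Lemma sorted_ltn_head s x : sorted ltn (rcons s x) -> head 0 (rcons s x) <= x.
Proof. by case: s => //= y s /path_ltn_last; rewrite last_rcons. Qed.

Lemma nth_flatten_block bs1 (b : seq nat) bs2 m : m < size b ->
  nth 0 (flatten (bs1 ++ b :: bs2)) (size (flatten bs1) + m) = nth 0 b m.
Proof.
by move=> mb; rewrite flatten_cat nth_cat ltnNge leq_addr addKn nth_cat mb.
Qed.

Lemma descent_gap_block bs1 (b : seq nat) bs2 k : 0 < k < size b ->
  descent_gap (flatten (bs1 ++ b :: bs2)) (size (flatten bs1) + k) = descent_gap b k.
Proof.
move=> kb; rewrite /descent_gap /gap kb.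
have -> : size (flatten (bs1 ++ b :: bs2)) =
    size (flatten bs1) + (size b + size (flatten bs2)).
  by rewrite flatten_cat !size_cat.
rewrite nth_flatten_block; last by case/andP: kb.
have -> : (size (flatten bs1) + k).-1 = size (flatten bs1) + k.-1 by lia.
by rewrite nth_flatten_block; lia.
Qed.

Lemma sorted_ltn_no_descent b : sorted ltn b -> forall i, descent_gap b i = false.
Proof.
move=> sb i; apply/negbTE/negP => /andP[/andP[i0 ib]].
have := sorted_ltn_nth ltn_trans 0 sb => /(_ i.-1 i).
by rewrite !inE; lia.
Qed.

(** With an entry [x] just before [y], the turn [x < y > z] gives [x < z]; with an entry [w] just
    after [z], the turn [y > z < w] gives [y < w]. As blocks increase, either inequality bounds the
    head of the first block by the last entry of the second. *)
Lemma sorted_blocks_turn bs1 b' y z c' bs2 :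
    sorted ltn (rcons b' y) -> sorted ltn (z :: c') ->
    layered (flatten (bs1 ++ [:: rcons b' y, z :: c' & bs2])) ->
    (b' != [::]) || (c' != [::]) -> z < y ->
  head 0 (rcons b' y) <= last z c'.
Proof.
move=> sb sc lay /orP[] ne ltzy.
  case: (lastP b') ne sb lay => // b x _ sb lay; rewrite head_rcons2.
  have ltxy : x < y by move: sb; rewrite -cats1 -cats1 -catA /= => /cat_sorted2[_] /= /andP[].
  apply: leq_trans (sorted_ltn_head _) _; first by move: sb; rewrite -cats1 => /cat_sorted2[].
  apply: leq_trans (path_ltn_last sc); apply: ltnW.
  apply: (@layered_turn (flatten bs1 ++ b) x y z (c' ++ flatten bs2)).
    by move: lay; rewrite flatten_cat /= -!cats1 -!catA.
  by rewrite /turn ltxy ltzy.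
case: c' ne sc lay => // w c _ /= /andP[ltzw sc] lay.
apply: leq_trans (sorted_ltn_head sb) (leq_trans _ (path_ltn_last sc)); apply: ltnW.
apply: (@layered_turn (flatten bs1 ++ b') y z w (c ++ flatten bs2)).
  by move: lay; rewrite flatten_cat /= -!cats1 -!catA.
by rewrite /turn ltzw ltzy orbT.
Qed.

(** In increasing blocks [head] is the minimum and [last] the maximum, so the left side says that no
    two reversed neighbours merge. Every descent is cut, and a neighbouring gap is uncut exactly
    when one of the two blocks meeting there has a second entry. *)
Lemma sorted_blocksP (bs : seq (seq nat)) :
    all (fun b => (b != [::]) && sorted ltn b) bs ->
    uniq (flatten bs) -> layered (flatten bs) ->
  sorted (fun b c => head 0 b <= last 0 c) bs <->
  forall i, descent_gap (flatten bs) i ->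
    exists j, [/\ j.+1 = i \/ j = i.+1, gap (flatten bs) j & ~~ cut bs j].
Proof.
move=> abs us lay; split; last first.
  move=> free; apply: sorted_split => bs1 b c bs2 ebs.
  move: abs; rewrite ebs all_cat /= => /and4P[_ /andP[b0 sb] /andP[c0 sc] _].
  case: (lastP b) b0 sb ebs => // b' y _ sb ebs.
  case: c c0 sc ebs => //= z c' _ sc ebs.
  have eflat : flatten bs = (flatten bs1 ++ b') ++ [:: y, z & c' ++ flatten bs2].
    by rewrite ebs flatten_cat /= -cats1 -!catA.
  have [ltyz|ltzy|eyz] := ltngtP y z; last first.
  - by move: us; rewrite eflat cat_uniq /= eyz mem_head /= !andbF.
  - case: (boolP ((b' != [::]) || (c' != [::]))) => [|].
      by move=> ne; apply: (@sorted_blocks_turn bs1 _ _ _ _ bs2) => //; rewrite -ebs.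
    (* Two singletons meet at a descent: both neighbouring gaps would be cuts, against [free]. *)
    rewrite negb_or !negbK => /andP[/eqP b0 /eqP c0]; subst b' c'.
    have /free[j []] : descent_gap (flatten bs) (size (flatten bs1)).+1.
      apply/descent_gapP; exists (flatten bs1), y, z, (flatten bs2).
      by split; rewrite // eflat cats0.
    case=> [[->]|->] _; rewrite ebs.
      by rewrite -[size _]addn0 cut_cat // cut0.
    by rewrite -addn2 cut_cat //= cut0.
  - exact: leq_trans (sorted_ltn_head sb) (leq_trans (ltnW ltyz) (path_ltn_last sc)).
move=> srt i dgi.
have /andP[/andP[i0 ltis] _] := dgi.
have /descent_gapP[s1 [x [y [s2 [es ei ltyx]]]]] := dgi.
(* A descent cannot lie inside an increasing block, so [i] is a cut. *)
case: (cut_or_inside ltis) => [|[bs1 [b [bs2 [k [ebs eik /andP[k0 kb]]]]]]]; last first.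
  move: abs; rewrite ebs all_cat /= => /and3P[_ /andP[_ sb] _].
  by move: dgi; rewrite ebs eik descent_gap_block ?k0 // sorted_ltn_no_descent.
move/cut_split=> [bs1 [bs2 [ebs eib]]].
have /eqP : flatten bs1 ++ flatten bs2 = rcons s1 x ++ y :: s2.
  by rewrite -flatten_cat -ebs es cat_rcons.
rewrite eqseq_cat; last by rewrite size_rcons -eib.
case/andP=> /eqP + /eqP.
case: (lastP bs1) ebs eib => [|bs1' b] ebs eib; first by case: (s1).
move: abs; rewrite {1}ebs all_cat all_rcons => /andP[/andP[/andP[b0 sb] _]].
case: bs2 ebs => //= c bs2 ebs /andP[/andP[c0 sc] _].
rewrite -cats1 flatten_cat /= cats0.
case: (lastP b) b0 sb ebs eib => // b' x' _ sb ebs eib.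
rewrite -rcons_cat => /rcons_inj[es1 ex].
case: c c0 sc ebs => //= y' c' _ sc ebs [ey es2]; subst x' y'.
have := srt; rewrite {1}ebs cat_rcons => /cat_sorted2[_] /= /andP[+ _].
have szs : size (flatten bs) = size s1 + (size s2).+2 by rewrite es size_cat.
(* Two singletons would give [x <= y]; a longer right block leaves gap [i.+1] uncut, a longer left
   block gap [i.-1]. *)
case: (posnP (size b')) => [/size0nil eb'|b'0 _].
  subst b' => /=; case: c' sc es2 ebs => [|w c'] sc es2 ebs; first by rewrite leqNgt ltyx.
  move=> _; exists i.+1; split; first by right.
    by rewrite /gap szs -es2 ei /=; lia.
  rewrite ebs eib -addn1 cut_inside //.
exists i.-1; split; first by left; lia.
  by rewrite /gap szs ei -es1 size_cat /=; lia.
rewrite ebs cat_rcons ei -es1 size_cat /= cut_inside // size_rcons; lia.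
Qed.

Lemma falls_blocks (fs : seq (seq nat)) :
  all (fun f => (f != [::]) && sorted gtn f) fs =
  all (fun b => (b != [::]) && sorted ltn b) (map rev fs).
Proof.
rewrite all_map; apply: eq_all => f /=.
by rewrite rev_sorted -!size_eq0 size_rev.
Qed.

Lemma sorted_falls_blocks (fs : seq (seq nat)) :
  sorted (fun f g => last 0 f <= head 0 g) fs =
  sorted (fun b c => head 0 b <= last 0 c) (map rev fs).
Proof.
rewrite sorted_map; apply: eq_sorted => f g /=.
by case/lastP: f => [|f x]; case: g => [|y g];
  rewrite ?rev_rcons ?last_rcons ?rev_cons ?last_rcons.
Qed.

Lemma no_descent_sorted_ltn (b : seq nat) : 
  uniq b -> (forall i, ~~ descent_gap b i) -> sorted ltn b.
Proof.
move=> ub nd; apply: sorted_split => s1 x y s2 e.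
have := nd (size s1).+1; apply: contraR; rewrite -leqNgt => leyx.
apply/descent_gapP; exists s1, x, y, s2; split=> //.
rewrite ltn_neqAle leyx andbT; apply/eqP => exy; move: ub.
by rewrite e cat_uniq /= exy mem_head !andbF.
Qed.

Lemma blocks_from_sorted (B : pred nat) (s : seq nat) :
  uniq s -> (forall i, descent_gap s i -> B i) ->
  all (fun b => (b != [::]) && sorted ltn b) (blocks_from B 1 s).
Proof.
move=> us dB; apply/allP => b b_in.
rewrite (allP (blocks_from_neq0 B 1 s)) //=.
have [bs1 [bs2 ebs]] : exists bs1 bs2, blocks_from B 1 s = bs1 ++ b :: bs2.
  by case/splitPr: b_in => bs1 bs2; exists bs1, bs2.
have es := flatten_blocks_from B 1 s; rewrite ebs flatten_cat /= in es.
apply: no_descent_sorted_ltn => [|i].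
  by move: us; rewrite -es catA !cat_uniq => /and3P[/and3P[_ _]].
apply/negP => dgb; have /andP[ib _] := dgb.
have dg : descent_gap s (size (flatten bs1) + i).
  by rewrite -es -[b ++ _]/(flatten (b :: bs2)) -flatten_cat descent_gap_block.
have /andP[dgap _] := dg.
by have := dB _ dg; rewrite -(@cut_blocks_from B 0 s) // ebs cut_inside.
Qed.

(** The reversed falls of [w] are the blocks of [s]. Nonempty decreasing lists are the falls of
    their concatenation exactly when no two neighbours merge, which [sorted_blocksP] translates into
    the condition on bars. *)
Lemma flip_preimage (s w : seq nat) : uniq s -> layered s ->
  flip w = s <->
  exists2 S : pred nat, admissible s S & w = reverse_blocks (bar s S) s.
Proof.
move=> us lay; split=> [fw|[S [Sasc free] ->]].
  case: (fallsP w); rewrite falls_blocks sorted_falls_blocks => ew.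
  set bs := map rev (falls w) => abs srt.
  have es : s = flatten bs by rewrite -fw.
  have abs0 : all (fun b => b != [::]) bs by apply: sub_all abs => b /andP[].
  have free : forall i, descent_gap s i ->
      exists j, [/\ j.+1 = i \/ j = i.+1, gap s j & ~~ cut bs j].
    by rewrite es; apply/sorted_blocksP; rewrite -?es.
  (* The secondary bars are the cuts at ascents. As all descents are cut and neighbouring entries
     are distinct, the bars are then exactly the cuts. *)
  pose S i := ascent_gap s i && cut bs i.
  have barE i : gap s i -> bar s S i = cut bs i.
    move=> gi; rewrite /bar /S.
    have neq : nth 0 s i.-1 != nth 0 s i.
      case/andP: gi => i0 ilt; rewrite nth_uniq //; first by lia.
      exact: leq_ltn_trans (leq_pred i) ilt.
    case dg: (descent_gap s i) => /=; last first.
      have -> // : ascent_gap s i.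
      by move: dg; rewrite /descent_gap /ascent_gap gi /=; lia.
    have := gi => /andP[i0]; rewrite {1}es => /cut_or_inside[-> //|].
    case=> bs1 [b [bs2 [k [ebs ei kb]]]].
    move: abs; rewrite ebs all_cat /= => /and3P[_ /andP[_ sb] _].
    by move: dg; rewrite es ebs ei descent_gap_block // sorted_ltn_no_descent.
  exists S.
    split=> [i /andP[] //|i /free[j [nj gj ncj]]]; exists j; split=> //.
    by rewrite barE.
  rewrite /reverse_blocks {2}es blocks_from_flatten //.
    by rewrite map_revK flatten_falls.
  by move=> j; rewrite -es add0n => gj; apply: barE.
rewrite /reverse_blocks; set bs := blocks_from _ 1 s.
have es : flatten bs = s by apply: flatten_blocks_from.
have abs : all (fun b => (b != [::]) && sorted ltn b) bs.
  by apply: blocks_from_sorted => // i dg; rewrite /bar dg.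
rewrite /flip falls_flatten; first by rewrite map_revK.
  by rewrite falls_blocks map_revK.
rewrite sorted_falls_blocks map_revK.
apply/sorted_blocksP; rewrite ?es // => i /free[j [nj gj nB]].
by exists j; split=> //; rewrite /bs cut_blocks_from.
Qed.

(** Deleting secondary bars only frees gaps, so some [S] is admissible iff the empty one is. *)
Lemma admissible_pred0 s S : admissible s S -> admissible s pred0.
Proof.
case=> _ free; split=> // i /free[j [nj gj nb]]; exists j; split=> //.
by apply: contra nb; rewrite /bar orbF => ->.
Qed.

(** * Words of permutations *)

Lemma perm_word n (t : 'S_n) : perm_eq (word t) (iota 1 n).
Proof.
have -> : iota 1 n = [seq (val i).+1 | i : 'I_n].
  by rewrite -[1]addn0 iotaDl -val_enum_ord -map_comp.
rewrite /word; apply: uniq_perm.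
- by rewrite map_inj_uniq ?enum_uniq // => i j [] /val_inj/perm_inj.
- by rewrite map_inj_uniq ?enum_uniq // => i j [] /val_inj.
move=> k; apply/mapP/mapP => -[i _ ->]; last first.
  by exists (t^-1 i)%g; rewrite ?mem_enum // permKV.
by exists (t i); rewrite ?mem_enum.
Qed.

Lemma word_of_perm n (s : seq nat) : perm_eq s (iota 1 n) -> exists t : 'S_n, word t = s.
Proof.
have sz : size (iota 1 n) == n by rewrite size_iota.
case/(@tuple_permP _ _ _ (Tuple sz)) => p ->; exists p.
apply: eq_map => i; rewrite (tnth_nth 0) /= nth_iota //.
Qed.

Lemma word_inj n : injective (@word n).
Proof.
move=> t u /eq_in_map etu; apply/permP => i; apply/val_inj.
by have [] := etu i (mem_enum _ i).
Qed.

Lemma uniq_word n (t : 'S_n) : uniq (word t).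
Proof. by rewrite (perm_uniq (perm_word t)) iota_uniq. Qed.

Lemma perm_reverse_blocks B s : perm_eq (reverse_blocks B s) s.
Proof.
by rewrite -[X in perm_eq _ X](flatten_blocks_from B 1) perm_flatten_rev.
Qed.

(** Reversing blocks only permutes the entries, so every list obtained from bars is the word of a
    permutation. *)
Lemma word_flip_preimage n (t : 'S_n) : layered (word t) -> forall w : seq nat,
  (exists2 p : 'S_n, word p = w & flip (word p) = word t) <->
  (exists2 S : pred nat, admissible (word t) S &
     w = reverse_blocks (bar (word t) S) (word t)).
Proof.
move=> lay w; split=> [[p <-]|]; first by move/(flip_preimage _ (uniq_word t) lay).
move=> [S ad ew].
have [p pw] : exists p : 'S_n, word p = w.
  by apply: word_of_perm; rewrite ew (perm_trans (perm_reverse_blocks _ _)) ?perm_word.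
exists p => //; rewrite pw; apply/(flip_preimage _ (uniq_word t) lay).
by exists S.
Qed.

Lemma pop_stackedP n (t : 'S_n) : layered (word t) ->
  pop_stacked t <-> admissible (word t) pred0.
Proof.
move=> lay; split=> [/existsP[p /eqP fp]|ad].
  have /(word_flip_preimage lay)[S /admissible_pred0] :
      exists2 q : 'S_n, word q = word p & flip (word q) = word t by exists p.
  by [].
have [p _ fp] := proj2 (word_flip_preimage lay _) (ex_intro2 _ _ (pred0 : pred nat) ad erefl).
by apply/existsP; exists p; rewrite fp.
Qed.

(** * Compositions of layered permutations *)

(** Inside a fall each gap is a descent, and between two falls [last <= head] rules one out. *)
Lemma descent_gap_falls s i : gap s i -> descent_gap s i = ~~ cut (falls s) i.
Proof.
move=> gi; have [es afs srt] := fallsP s.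
have /andP[i0] := gi; rewrite -{1}es => /cut_or_inside[ci|].
  rewrite ci; apply/negbTE/negP => /descent_gapP[s1 [x [y [s2 [es' ei ltyx]]]]].
  have [bs1 [bs2 [efs ei']]] := cut_split ci.
  have /eqP : flatten bs1 ++ flatten bs2 = rcons s1 x ++ y :: s2.
    by rewrite -flatten_cat -efs es es' cat_rcons.
  rewrite eqseq_cat; last by rewrite size_rcons -ei'.
  case/andP=> /eqP + /eqP.
  move: srt afs; rewrite efs; case: (lastP bs1) => [|bs f]; first by case: (s1).
  rewrite -cats1 -catA flatten_cat /= cats0 => /cat_sorted2[_] /=.
  case: bs2 {efs} => //= g bs2 /andP[lefg _].
  rewrite all_cat /= => /and4P[_ /andP[f0 _] /andP[g0 _] _].
  case: (lastP f) f0 lefg => // f' x' _; rewrite last_rcons => lefg.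
  rewrite -rcons_cat => /rcons_inj[_ ex]; case: g g0 lefg => //= y' g _ lexy [ey _].
  by rewrite -ex -ey ltnNge lexy in ltyx.
case=> bs1 [b [bs2 [k [efs -> kb]]]].
rewrite efs cut_inside // -{1}es efs descent_gap_block //=.
move: afs; rewrite efs all_cat /= => /and3P[_ /andP[_ sb] _].
have := sorted_ltn_nth (rev_trans ltn_trans) 0 sb => /(_ k.-1 k).
by rewrite /descent_gap /gap kb !inE /=; lia.
Qed.

(** Without secondary bars, the bars are the gaps inside the falls and the free gaps are the cuts
    between falls. *)
Lemma admissible_pred0_cut s : admissible s pred0 <->
  forall i, gap s i -> ~~ cut (falls s) i ->
    exists j, [/\ j.+1 = i \/ j = i.+1, gap s j & cut (falls s) j].
Proof.
split=> [[_ free] i gi|free].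
  rewrite -descent_gap_falls // => /free[j [nj gj]].
  by rewrite /bar orbF descent_gap_falls // negbK => cj; exists j.
split=> // i dg; have /andP[gi _] := dg.
move: dg; rewrite descent_gap_falls // => /(free _ gi)[j [nj gj cj]].
by exists j; rewrite /bar orbF descent_gap_falls // cj.
Qed.

(** The possible layer sizes of a pop-stacked layered permutation. The default 0 lets the empty list
    pass; a positive sum excludes it later. *)
Definition good_composition (c : seq nat) : bool :=
  [&& all (fun m => 0 < m <= 3) c, head 0 c <= 2, last 0 c <= 2
    & (size c == 1) ==> (c == [:: 1])].

Lemma cut_size_flatten bs1 bs2 i : i = size (flatten bs1) -> cut (bs1 ++ bs2) i.
Proof. by move=> ->; rewrite -[size _]addn0 cut_cat // cut0. Qed.

(* An uncut gap lies inside a block, and only the first or the last gap inside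
   a block has a neighbouring cut. *)
Lemma good_compositionP (bs : seq (seq nat)) : all (fun b => b != [::]) bs ->
  (forall i, 0 < i < size (flatten bs) -> ~~ cut bs i ->
    exists j, [/\ j.+1 = i \/ j = i.+1, 0 < j < size (flatten bs) & cut bs j]) <->
  good_composition (shape bs).
Proof.
move=> abs.
have pos bs1 : all (fun b : seq nat => b != [::]) bs1 -> bs1 != [::] -> 0 < size (flatten bs1).
  by case: bs1 => //= b bs1 /andP[b0 _] _; case: b b0.
split=> [free|good].
  (* An inner gap of [b] has a neighbouring cut only at an end of [b], and that end must not be an
     end of the whole word. *)
  have inside bs1 b bs2 k : bs = bs1 ++ b :: bs2 -> 0 < k < size b ->
      [\/ k = 1 /\ bs1 != [::], k.+1 = size b /\ bs2 != [::] | false].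
    move=> ebs kb.
    have esz : size (flatten bs) = size (flatten bs1) + (size b + size (flatten bs2)).
      by rewrite ebs flatten_cat !size_cat.
    have [||j []] := free (size (flatten bs1) + k).
    - by rewrite esz; lia.
    - by rewrite ebs cut_inside.
    case=> [ej|->]; rewrite esz => gj.
      case: (eqVneq k 1) => [k1 _|k1].
        by constructor 1; split=> //; apply/eqP => e; rewrite e k1 /= in ej gj; lia.
      have -> : j = size (flatten bs1) + k.-1 by lia.
      by rewrite ebs cut_inside //; lia.
    case: (eqVneq k.+1 (size b)) => [kb' _|kb'].
      by constructor 2; split=> //; apply/eqP => e; rewrite e /= in gj; lia.
    by rewrite -addnS ebs cut_inside //; lia.
  have head_le b bs2 : bs = b :: bs2 -> size b <= 2.
    move=> e; rewrite leqNgt; apply/negP => b3.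
    by case: (inside [::] b bs2 1 e) => //; first lia; case=> // e1; lia.
  apply/and4P; split.
  - apply/allP => _ /mapP[b b_in ->].
    have [bs1 [bs2 ebs]] : exists bs1 bs2, bs = bs1 ++ b :: bs2.
      by case/splitPr: b_in => bs1 bs2; exists bs1, bs2.
    have b0 : 0 < size b by have := allP abs _ b_in; case: (b).
    rewrite b0 leqNgt; apply/negP => b3.
    (* In a block of size at least 4, offset 2 has uncut gaps on both sides. *)
    by case: (inside bs1 b bs2 2 ebs) => [|[]|[]|] //; lia.
  - by case: (bs) head_le => //= b bs2 /(_ b bs2 erefl).
  - case: (lastP bs) inside => // bs1 b inside.
    rewrite /shape map_rcons last_rcons leqNgt; apply/negP => b3.
    (* The last inner gap of a last block of size at least 3 has an uncut gap before it and no gap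
       after it. *)
    by case: (inside bs1 b [::] (size b).-1) => [||[]|[]|] //; rewrite ?cats1 //; lia.
  - apply/implyP; case: (bs) inside abs => [|b [|c bs']] //= inside /andP[b0 _] _.
    have [b1|b1] := leqP (size b) 1; last by case: (inside [::] b [::] 1 erefl b1) => [[]|[]|].
    by case: b b0 b1 {inside} => [|x []].
move=> i gi nci; have /andP[i0 ltis] := gi.
case: (cut_or_inside ltis) => [ci|[bs1 [b [bs2 [k [ebs ei kb]]]]]]; first by rewrite ci in nci.
have esz : size (flatten bs) = size (flatten bs1) + (size b + size (flatten bs2)).
  by rewrite ebs flatten_cat !size_cat.
move: abs; rewrite {1}ebs all_cat /= => /and3P[abs1 _ abs2].
have b3 : size b <= 3.
  case/andP: good => /allP h _; have /h/andP[] // : size b \in shape bs.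
  by rewrite ebs; apply: map_f; rewrite mem_cat mem_head orbT.
have left_cut : bs1 != [::] -> k = 1 ->
    exists j, [/\ j.+1 = i \/ j = i.+1, 0 < j < size (flatten bs) & cut bs j].
  move=> /(pos _ abs1) p1 k1; exists (size (flatten bs1)).
  by split; [left; lia | rewrite esz; lia | rewrite ebs cut_size_flatten].
have right_cut : bs2 != [::] -> k.+1 = size b ->
    exists j, [/\ j.+1 = i \/ j = i.+1, 0 < j < size (flatten bs) & cut bs j].
  move=> /(pos _ abs2) p2 k1; exists i.+1.
  split; [by right | by rewrite esz; lia | rewrite ebs -cat_rcons cut_size_flatten //].
  by rewrite -cats1 flatten_cat size_cat /= cats0; lia.
(* A single block has no inner gap. An end block of size at most 2 has at most one, next to the
   adjoining block; a middle block of size at most 3 has only a first and a last one. *)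
case: (eqVneq bs1 [::]) left_cut => [e1 _|_ left_cut].
  case: (eqVneq bs2 [::]) right_cut => [e2|_ right_cut].
    move: good; rewrite ebs e1 e2 => /and4P[_ _ _] /= /eqP[]; lia.
  apply: right_cut => //; move: good; rewrite ebs e1 => /and4P[_ /= b2 _ _]; lia.
case: (eqVneq bs2 [::]) right_cut => [e2 _|_ right_cut].
  apply: left_cut => //; move: good; rewrite ebs e2 cats1 /shape map_rcons => /and4P[_ _ + _].
  rewrite last_rcons; lia.
case: (eqVneq k 1) => [k1|k1]; first exact: left_cut.
apply: right_cut => //; lia.
Qed.

(** * Layered permutations and their layer sizes *)

Lemma pairwise_flatten (T : Type) (r : rel T) (bs : seq (seq T)) :
  pairwise r (flatten bs) = pairwise (allrel r) bs && all (pairwise r) bs.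
Proof.
elim: bs => //= b bs IH; rewrite pairwise_cat IH.
have -> : allrel r b (flatten bs) = all (allrel r b) bs.
  elim: bs {IH} => [|c bs IH] /=; first by rewrite allrel0r.
  by rewrite allrel_catr IH.
by rewrite -!andbA; congr andb; rewrite andbCA.
Qed.

(** Transitivity of [allrel ltn] goes through an element of the middle list, hence the
    nonemptiness. *)
Lemma pairwise_allrel (fs : seq (seq nat)) : all (fun f => f != [::]) fs ->
  sorted (allrel ltn) fs = pairwise (allrel ltn) fs.
Proof.
move=> fs0; apply: (@sorted_pairwise_in _ [pred f | f != [::]]) => // f g h.
rewrite !inE; case: f => // x f _ _ _ /allrelP gf /allrelP fh.
apply/allrelP => y z yg zh; apply: ltn_trans (gf y x yg _) (fh x z _ zh); exact: mem_head.
Qed.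

Lemma sorted_allrel_map_rev (fs : seq (seq nat)) :
  sorted (allrel ltn) (map rev fs) = sorted (allrel ltn) fs.
Proof.
rewrite sorted_map; apply: eq_sorted => f g /=.
by apply: eq_allrel_mem2 => x; rewrite mem_rev.
Qed.

Lemma layered_sorted_flip s : layered s -> sorted ltn (flip s).
Proof.
move=> lay; have [_ afs _] := fallsP s.
rewrite falls_blocks in afs.
rewrite sorted_pairwise; last exact: ltn_trans.
rewrite /flip pairwise_flatten -pairwise_allrel; last first.
  by apply: sub_all afs => b /andP[].
rewrite sorted_allrel_map_rev [X in X && _]lay; apply: sub_all afs => b /andP[_].
by rewrite sorted_pairwise //; exact: ltn_trans.
Qed.

(** The layers of the layered permutation with layer sizes [c]. *)
Definition composition_falls (c : seq nat) : seq (seq nat) :=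
  map rev (reshape c (iota 1 (sumn c))).

(** A layered permutation flips to the identity, so its reversed falls are the slices of [iota 1 n]
    of the given sizes. *)
Lemma layered_composition n s : layered s -> perm_eq s (iota 1 n) ->
  falls s = composition_falls (shape (falls s)).
Proof.
move=> lay ps; rewrite -[LHS]map_revK; congr map.
rewrite -[LHS]flattenK; congr reshape.
  by rewrite /shape -map_comp; apply: eq_map => f /=; rewrite size_rev.
rewrite -size_flatten flatten_falls (perm_size ps) size_iota.
apply: (irr_sorted_eq ltn_trans ltnn); first exact: layered_sorted_flip.
  exact: iota_ltn_sorted.
by move=> x; rewrite (perm_mem (perm_flatten_rev _)) flatten_falls (perm_mem ps).
Qed.

Lemma shape_composition_falls c : shape (composition_falls c) = c.
Proof.
rewrite /composition_falls /shape -map_comp.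
rewrite -[RHS](@reshapeKl _ c (iota 1 (sumn c))) ?size_iota //.
by apply: eq_map => f /=; rewrite size_rev.
Qed.

Lemma perm_composition c : perm_eq (flatten (composition_falls c)) (iota 1 (sumn c)).
Proof.
apply: perm_trans (perm_flatten_rev _) _.
by rewrite reshapeKr ?size_iota.
Qed.

(** Slices of [iota] increase and each lies below the next, and positive parts make them nonempty;
    so the reversed slices cannot merge. *)
Lemma composition_fallsP c : all (ltn 0) c ->
  falls (flatten (composition_falls c)) = composition_falls c /\
  layered (flatten (composition_falls c)).
Proof.
move=> c0; set bs := reshape c (iota 1 (sumn c)).
have abs0 : all (fun b => b != [::]) bs.
  apply/allP => b b_in; have : size b \in shape bs by apply: map_f.
  rewrite reshapeKl ?size_iota // => /(allP c0); by case: (b).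
have : pairwise ltn (flatten bs).
  by rewrite reshapeKr ?size_iota // -sorted_pairwise ?iota_ltn_sorted //; exact: ltn_trans.
rewrite pairwise_flatten -pairwise_allrel // => /andP[srt abs].
have efs : falls (flatten (composition_falls c)) = composition_falls c.
  apply: falls_flatten.
    rewrite falls_blocks map_revK; apply/allP => b b_in.
    rewrite (allP abs0) //= sorted_pairwise ?(allP abs) //; exact: ltn_trans.
  rewrite sorted_falls_blocks map_revK.
  apply: (sub_in_sorted (P := [pred b | b != [::]])) srt => // -[|x f] [|y g] //= _ _.
  move=> /allrelP h; apply: ltnW; apply: h; rewrite ?mem_head //; exact: mem_last.
by split=> //; rewrite /layered efs sorted_allrel_map_rev.
Qed.

(** * Enumeration of the compositions *)

(* What may follow the first part of a good composition: nonempty compositions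
   of [n] into parts 1, 2, 3 with the last part at most 2. *)
Fixpoint tails n : seq (seq nat) :=
  if n is n1.+1 then
    (if n1 is n2.+1 then
      (if n2 is n3.+1 then
         map (cons 1) (tails n1) ++ map (cons 2) (tails n2) ++ map (cons 3) (tails n3)
       else [:: [:: 2]; [:: 1; 1]])
     else [:: [:: 1]])
  else [::].

(** As [tails 0] is empty, [[:: 3]] is never produced, which keeps 3 from being a last part; last
    parts 1 and 2 enter through the initial values. *)
Lemma tailsS n : tails n.+3 =
  map (cons 1) (tails n.+2) ++ map (cons 2) (tails n.+1) ++ map (cons 3) (tails n).
Proof. by []. Qed.

Lemma mem_map_cons (m k : nat) c (L : seq (seq nat)) :
  (m :: c \in map (cons k) L) = (m == k) && (c \in L).
Proof.
apply/mapP/andP => [[d dL [-> ->]]|[/eqP -> cL]]; first by rewrite eqxx.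
by exists c.
Qed.

Lemma nil_map_cons (k : nat) (L : seq (seq nat)) : [::] \in map (cons k) L = false.
Proof. by apply/mapP => -[]. Qed.

Lemma tails_ind (P : nat -> Prop) :
  P 0 -> P 1 -> P 2 -> (forall n, P n -> P n.+1 -> P n.+2 -> P n.+3) -> forall n, P n.
Proof.
move=> P0 P1 P2 PS n; suff [] : [/\ P n, P n.+1 & P n.+2] by [].
by elim: n => // n [Pn Pn1 Pn2]; split=> //; apply: PS.
Qed.

Lemma mem_tails n (c : seq nat) : (c \in tails n) =
  [&& c != [::], all (fun m => 0 < m <= 3) c, last 0 c <= 2 & sumn c == n].
Proof.
have consE d e : (d :: e == [::] :> seq nat) = false by [].
have nilE d e : ([::] == d :: e :> seq nat) = false by [].
elim: c n => [|m c IH] n.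
  by case: n => [|[|[|n]]] //; rewrite tailsS !mem_cat !nil_map_cons.
case: n => [|[|[|n]]].
- by rewrite in_nil /=; case: (all _ c); lia.
- rewrite inE eqseq_cons; case: c {IH} => [|d c]; rewrite ?eqxx ?consE /=; first by lia.
  by case: (all _ c); lia.
- rewrite !inE !eqseq_cons; case: c {IH} => [|d [|e c]].
  + by rewrite eqxx nilE /=; lia.
  + by rewrite !eqseq_cons eqxx !consE /=; lia.
  + by rewrite !eqseq_cons !consE /=; case: (all _ c); lia.
rewrite tailsS !mem_cat !mem_map_cons !IH.
case: c {IH} => [|d c]; first by rewrite eqxx consE /=; lia.
by rewrite !consE /=; case: (all _ c); lia.
Qed.

Lemma uniq_tails n : uniq (tails n).
Proof.
have inj k : injective (cons k : seq nat -> seq nat) by move=> c d [].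
elim/tails_ind: n => // n Un Un1 Un2.
rewrite tailsS !cat_uniq !map_inj_uniq // Un Un1 Un2 !andbT !andTb.
apply/andP; split; apply/hasPn => c; rewrite ?mem_cat.
  by case/orP=> /mapP[d _ ->] /=; rewrite mem_map_cons.
by case/mapP=> d _ -> /=; rewrite mem_map_cons.
Qed.

(** The first part is 1 or 2 and is followed by a nonempty tail, except in the composition of 1. *)
Definition good_compositions n : seq (seq nat) :=
  if n is n1.+1 then
    (if n1 is n2.+1 then map (cons 1) (tails n1) ++ map (cons 2) (tails n2)
     else [:: [:: 1]])
  else [::].

Lemma mem_good_compositions n (c : seq nat) : 0 < n ->
  (c \in good_compositions n) = good_composition c && (sumn c == n).
Proof.
have consE d e : (d :: e == [::] :> seq nat) = false by [].
case: n => [|[|n]] // _; case: c => [|m c]; rewrite /good_composition //.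
- rewrite inE !eqseq_cons; case: c => [|d c]; first by rewrite eqxx /=; lia.
  by rewrite consE /=; case: (all _ c); lia.
- by rewrite mem_cat !nil_map_cons.
rewrite mem_cat !mem_map_cons !mem_tails eqseq_cons.
case: c => [|d c]; first by rewrite eqxx /=; lia.
by rewrite consE /=; case: (all _ c); lia.
Qed.

Lemma uniq_good_compositions n : uniq (good_compositions n).
Proof.
have inj k : injective (cons k : seq nat -> seq nat) by move=> c d [].
case: n => [|[|n]] //; rewrite cat_uniq !map_inj_uniq // !uniq_tails /= andbT.
by apply/hasPn => c /mapP[d _ ->] /=; rewrite mem_map_cons.
Qed.

(** Taking layer sizes is a bijection from [LI n] onto the good compositions of [n], with inverse
    given by [composition_falls]. *)
Lemma card_LI n : 0 < n -> #|LI n| = size (good_compositions n).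
Proof.
move=> n0; pose f (t : 'S_n) := shape (falls (word t)).
have -> : #|LI n| = size (map f (enum (LI n))) by rewrite size_map cardE.
apply: perm_size; apply: uniq_perm; last 1 first.
- move=> c; rewrite mem_good_compositions //; apply/mapP/andP.
    case=> t; rewrite mem_enum inE => /andP[lay /(pop_stackedP lay)].
    move/admissible_pred0_cut => ad ->; split.
      apply/good_compositionP; last by rewrite flatten_falls.
      by have [_ afs _] := fallsP (word t); apply: sub_all afs => b /andP[].
    by rewrite -size_flatten flatten_falls (perm_size (perm_word t)) size_iota.
  case=> gc /eqP sc.
  have c0 : all (ltn 0) c by case/andP: gc => h _; apply: sub_all h => m /andP[].
  have [efs lay] := composition_fallsP c0.
  have := perm_composition c; rewrite sc => /word_of_perm[t et].
  have eft : f t = c by rewrite /f et efs shape_composition_falls.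
  exists t => //; rewrite mem_enum inE et lay /=.
  rewrite -et in lay; apply/(pop_stackedP lay)/admissible_pred0_cut.
  have [es afs _] := fallsP (word t).
  have afs0 : all (fun b => b != [::]) (falls (word t)) by apply: sub_all afs => b /andP[].
  by have /(good_compositionP afs0) : good_composition (f t); rewrite ?eft // es.
- rewrite map_inj_in_uniq ?enum_uniq // => t u; rewrite !mem_enum !inE.
  move=> /andP[layt _] /andP[layu _] eft; apply: word_inj.
  rewrite -(flatten_falls (word t)) -(flatten_falls (word u)).
  rewrite (layered_composition layt (perm_word t)) (layered_composition layu (perm_word u)).
  by rewrite -/(f t) eft.
- exact: uniq_good_compositions.
Qed.

(** * The generating function *)

Local Open Scope ring_scope.

Lemma fps_mulXn (R : nzRingType) k (f : fps R) n :
  fps_mul (fps_poly 'X^k) f n = if (k <= n)%N then f (n - k)%N else 0.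
Proof.
rewrite /fps_mul /fps_poly; case: leqP => [lekn|ltnk].
  have lt : (k < n.+1)%N by [].
  rewrite (bigD1 (Ordinal lt)) //= coefXn eqxx mul1r big1 ?addr0 // => i neq.
  by rewrite coefXn (negPf (neq : (i : nat) != k)) mul0r.
by rewrite big1 // => i _; rewrite coefXn ltn_eqF ?mul0r // (leq_trans (ltn_ord i)).
Qed.

Lemma fps_mulDl (R : nzRingType) (p q : {poly R}) (f : fps R) n :
  fps_mul (fps_poly (p + q)) f n = fps_mul (fps_poly p) f n + fps_mul (fps_poly q) f n.
Proof.
rewrite /fps_mul /fps_poly -big_split /=.
by apply: eq_bigr => i _; rewrite coefD mulrDl.
Qed.

Lemma fps_mulNl (R : nzRingType) (p : {poly R}) (f : fps R) n :
  fps_mul (fps_poly (- p)) f n = - fps_mul (fps_poly p) f n.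
Proof.
rewrite /fps_mul /fps_poly -sumrN.
by apply: eq_bigr => i _; rewrite coefN mulNr.
Qed.

(** The tribonacci numbers 1, 1, 2, 4, 7, ... *)
Definition tribonacci : fps int := fps_inv (fps_poly (1 - ('X + 'X^2 + 'X^3))).

Lemma tribonacci_rec n :
  tribonacci n = (n == 0%N)%:R +
    (if (1 <= n)%N then tribonacci (n - 1)%N else 0) +
    (if (2 <= n)%N then tribonacci (n - 2)%N else 0) +
    (if (3 <= n)%N then tribonacci (n - 3)%N else 0).
Proof.
rewrite /tribonacci; set p := 1 - _ : {poly int}.
(* Writing 1 and ['X] as powers lets [fps_mulXn] turn each term into a shift. *)
have pE : p = 'X^0 - ('X^1 + 'X^2 + 'X^3) by rewrite expr0 expr1.
have U : fps_poly p 0%N \is a GRing.unit by rewrite /fps_poly pE !(coefB, coefD, coefXn).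
have := fps_mulV U n; rewrite -/p; set q := fps_inv _.
rewrite pE fps_mulDl fps_mulNl !fps_mulDl !fps_mulXn.
by rewrite /fps_poly coef1 leq0n subn0 => <-; ring.
Qed.

Lemma tribonacci0 : tribonacci 0 = 1.
Proof. by rewrite tribonacci_rec. Qed.

Lemma tribonacci1 : tribonacci 1 = 1.
Proof. by rewrite tribonacci_rec /= subnn tribonacci0. Qed.

Lemma tribonacci2 : tribonacci 2 = 2.
Proof. by rewrite tribonacci_rec /= subnn tribonacci0 tribonacci1. Qed.

Lemma tribonacciS n :
  tribonacci n.+3 = tribonacci n.+2 + tribonacci n.+1 + tribonacci n.
Proof. by rewrite tribonacci_rec /= !subSS !subn0 add0r. Qed.

(** Deleting the last part, 1 or 2, leaves any composition of [n] or [n - 1] into parts 1, 2, 3. The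
    proof compares recurrences. *)
Lemma size_tails n :
  (size (tails n.+1))%:R = tribonacci n + (if n is m.+1 then tribonacci m else 0) :> int.
Proof.
elim/tails_ind: n => [|||n IH0 IH1 IH2].
- by rewrite tribonacci0.
- by rewrite tribonacci1 tribonacci0.
- by rewrite tribonacci2 tribonacci1.
rewrite tailsS !size_cat !size_map !natrD IH0 IH1 IH2 tribonacciS.
(* For [n = 0] the second summand is not yet subject to the recurrence. *)
case: n {IH0 IH1 IH2} => [|n]; first by rewrite tribonacci2 tribonacci1 tribonacci0.
by rewrite (tribonacciS n); ring.
Qed.

Lemma LI_seriesE n : LI_series n.+2 = (size (tails n.+1))%:R + (size (tails n))%:R.
Proof. by rewrite /LI_series card_LI // size_cat !size_map natrD. Qed.

Theorem theorem14 :
  (LI_series =1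
     fps_add (fps_poly 'X)
       (fps_div (fps_poly (('X + 'X^2) ^+ 2))
                (fps_poly (1 - ('X + 'X^2 + 'X^3)))))%R /\
  (forall (n : nat) (tau : 'S_n), (0 < n)%N -> tau \in LI n ->
     forall w : seq nat,
       (exists2 pi : 'S_n, word pi = w & flip (word pi) = word tau) <->
       (exists2 S : pred nat, admissible (word tau) S &
          w = reverse_blocks (bar (word tau) S) (word tau))).
Proof.
split=> [n|n tau _]; last by rewrite inE => /andP[lay _]; apply: word_flip_preimage.
rewrite /fps_add /fps_div -/tribonacci.
(* A sum of pure powers, with ['X^3] repeated instead of a coefficient 2, so that the product
   becomes a sum of shifts. *)
have -> : ('X + 'X^2) ^+ 2 = 'X^2 + 'X^3 + 'X^3 + 'X^4 :> {poly int} by ring.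
rewrite !fps_mulDl !fps_mulXn /fps_poly coefX.
case: n => [|[|n]]; first by rewrite addr0.
  by rewrite /LI_series card_LI.
rewrite LI_seriesE size_tails; case: n => [|[|n]].
- by rewrite tribonacci0.
- by rewrite size_tails /= tribonacci0 tribonacci1.
by rewrite size_tails /= !subSS !subn0; ring.
Qed.
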